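(* For every $K\ge 1$ there is a constant $C=C(K)>0$, depending only on $K$, such that the following holds for every finite state space $\Omega$ (of any size $d=|\Omega|$), every irreducible transition matrix $P=[p(u,v)]_{u,v\in\Omega}$ with invariant distribution $\mu$, every probability distribution $\nu$ on $\Omega$ with $\|\nu/\mu\|_\infty\le K$, and every $n\in\mathbb{N}_+$. Let $R_n$ be the Maximal Likelihood Estimator matrix computed from the Markov chain generated by $P$ with initial distribution $\nu$ (see context). Then $$\mathbb{E}\left[\|R_n-D_\mu P\|_{\mathrm F}\right]\le \frac{C}{\sqrt{n\,\eta_p(P)}},$$ where $\eta_p(P)$ is the iterated Poincaré gap of $P$. Moreover, if $P$ is reversible and $H_n$ is the Symmetric Counting Estimator built from $P$ and $\nu$ (see context), then $$\mathbb{E}\left[\|R_n-D_\mu P\|_{\mathrm F}\right]\le \frac{C}{\sqrt{n\,\eta(P)}},\qquad \mathbb{E}\left[\|H_n-D_\mu P\|_{\mathrm F}\right]\le \frac{C}{\sqrt{n\,\eta(P)}},$$ where $\eta(P)$ is the spectral gap of $P$.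
   Context: $|\Omega|\ge 2$. $\|\cdot\|_{\mathrm F}$ is the Frobenius norm; $D_\mu$ is the diagonal matrix with diagonal $\mu$; $\|\nu/\mu\|_\infty=\max_u\nu(u)/\mu(u)$; $E_{uv}$ is the $\Omega\times\Omega$ matrix with entry $1$ at $(u,v)$ and $0$ elsewhere. $P$ acts on functions by $Ph(u)=\sum_v p(u,v)h(v)$. Let $\langle f,g\rangle_\mu=\sum_u\mu(u)f(u)g(u)$, $\|\cdot\|_\mu$ the associated norm, $L^0_{2,\mu}=\{h:\Omega\to\mathbb{R}:\sum_u\mu(u)h(u)=0\}$. The iterated Poincaré gap is $\eta_p(P)=\inf_{0\ne h\in L^0_{2,\mu}}\|(I-P)h\|_\mu/\|h\|_\mu$. $P$ is reversible if $\mu(u)p(u,v)=\mu(v)p(v,u)$ for all $u,v$; in that case the spectral gap is $\eta(P)=1-\sup_{0\ne h\in L^0_{2,\mu}}\langle h,Ph\rangle_\mu/\|h\|_\mu^2$. Maximal Likelihood Estimator: for the Markov chain $\{u_k\}_{k\ge1}$ with transition matrix $P$ and $u_1\sim\nu$, $R_n=\frac1n\sum_{k=1}^n E_{u_ku_{k+1}}$. Symmetric Counting Estimator: let $\tilde\Omega^2$ be the quotient of $\Omega^2$ by $(u_1,u_2)\sim(u_2,u_1)$, with classes written $\widetilde{(u_1,u_2)}$. Let $\{\tilde{u}_k\}_{k\ge1}$ be the Markov chain on $\tilde\Omega^2$ whose initial state is $\tilde u_1=\widetilde{(u,v)}$ with $u\sim\nu$ and then $v\sim p(u,\cdot)$,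 and whose transitions are: from $\widetilde{(u_1,u_2)}$, choose $(w_1,w_2)$ to be $(u_1,u_2)$ or $(u_2,u_1)$ with probability $1/2$ each, then draw $v$ with probability $p(w_2,v)$ and jump to $\widetilde{(w_2,v)}$. Let $\tilde F(\widetilde{(w_1,w_2)})=\frac12(E_{w_1w_2}+E_{w_2w_1})$. Then $H_n=\frac1n\sum_{k=1}^n\tilde F(\tilde u_k)$. *)

(* Defs.v *)
From HB Require Import structures.
From mathcomp Require Import all_boot all_order all_algebra.
From mathcomp Require Import all_classical all_reals all_analysis.

Set Implicit Arguments.
Unset Strict Implicit.
Unset Printing Implicit Defensive.

Import Order.TTheory GRing.Theory Num.Theory.

Local Open Scope classical_set_scope.
Local Open Scope ring_scope.
Local Open Scope quotient_scope.

Section FiniteChains.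
Context {R : realType} {Omega : finType}.
Implicit Types (p : Omega -> Omega -> R) (mu nu : Omega -> R).
Implicit Types (f g h : {ffun Omega -> R}).

(** Omega x Omega matrices are library matrices of size #|Omega|, rows and
    columns being numbered by enum_rank / enum_val. *)
Definition matrix_of p : 'M[R]_#|Omega| :=
  \matrix_(i, j) p (enum_val i) (enum_val j).

Definition diag_of mu : 'M[R]_#|Omega| := diag_mx (\row_i mu (enum_val i)).

Definition unit_mx (u v : Omega) : 'M[R]_#|Omega| :=
  delta_mx (enum_rank u) (enum_rank v).

Definition frobenius_norm m n (A : 'M[R]_(m, n)) : R :=
  Num.sqrt (\sum_i \sum_j A i j ^+ 2).

Definition is_distribution mu : Prop :=
  (forall u, 0 <= mu u) /\ \sum_u mu u = 1.

Definition is_transition p : Prop := forall u, is_distribution (p u).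

Definition irreducible_chain p : Prop :=
  forall u v, exists n : nat,
    0 < (matrix_of p ^+ n) (enum_rank u) (enum_rank v).

Definition invariant_distribution p mu : Prop :=
  is_distribution mu /\ forall v, \sum_u mu u * p u v = mu v.

Definition reversible p mu : Prop :=
  forall u v, mu u * p u v = mu v * p v u.

(** The ratios are nonnegative in all uses, so the default value 0 of the
    maximum plays no role. *)
Definition max_ratio nu mu : R := \big[Num.max/0]_(u : Omega) (nu u / mu u).

Definition transition_op p h : {ffun Omega -> R} :=
  [ffun u => \sum_v p u v * h v].

Definition inner mu f g : R := \sum_u mu u * f u * g u.

Definition norm2 mu h : R := Num.sqrt (inner mu h h).

Definition mean_zero mu : set {ffun Omega -> R} :=
  [set h | \sum_u mu u * h u = 0].

Definition iterated_poincare_gap p mu : R :=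
  inf [set norm2 mu (h - transition_op p h) / norm2 mu h |
        h in [set h | mean_zero mu h /\ h != 0]].

Definition spectral_gap p mu : R :=
  1 - sup [set inner mu h (transition_op p h) / norm2 mu h ^+ 2 |
            h in [set h | mean_zero mu h /\ h != 0]].

End FiniteChains.

(** X 0 has law lam, and the one-step Markov property
    Pr(X_(n+1) = y | X_0 = x_0, ..., X_n = x_n) = q x_n y
    is written multiplicatively, so that nothing is required on null events. *)
Definition markov_chain {R : realType} {d : measure_display}
    {T : measurableType d} (Pr : probability T R) (S : finType)
    (lam : S -> R) (q : S -> S -> R) (X : nat -> T -> S) : Prop :=
  [/\ forall k x, measurable [set w | X k w = x],
      forall x, Pr [set w | X 0%N w = x] = (lam x)%:E &
      forall (n : nat) (x : nat -> S) (y : S),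
        Pr [set w | (forall i : nat, (i <= n)%N -> X i w = x i)
                    /\ X n.+1 w = y] =
        (Pr [set w | forall i : nat, (i <= n)%N -> X i w = x i]
         * (q (x n) y)%:E)%E].

Section UnorderedPairs.
Context {Omega : finType}.

Definition swap_rel : rel (Omega * Omega) :=
  fun a b => (a == b) || (a == (b.2, b.1)).

Lemma swap_rel_refl : reflexive swap_rel.
Proof. by move=> a; rewrite /swap_rel eqxx. Qed.

Lemma swap_rel_sym : symmetric swap_rel.
Proof.
move=> [a b] [c e]; rewrite /swap_rel !xpair_eqE.
by rewrite (eq_sym c a) (eq_sym e b) (eq_sym c b) (eq_sym e a) [(b == c) && _]andbC.
Qed.

Lemma swap_rel_trans : transitive swap_rel.
Proof.
move=> [a b] [c e] [f g]; rewrite /swap_rel /=.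
by case/orP=> /eqP [-> ->] /orP [] /eqP [-> ->]; rewrite eqxx ?orbT.
Qed.

Canonical swap_equiv :=
  EquivRel swap_rel swap_rel_refl swap_rel_sym swap_rel_trans.

Definition unordered_pair := {eq_quot swap_equiv}.

Definition unordered (u v : Omega) : unordered_pair :=
  \pi_{eq_quot swap_equiv} (u, v).

Definition unordered_repr (c : unordered_pair) : Omega * Omega :=
  @repr _ {eq_quot swap_equiv} c.

Lemma unordered_reprK :
  cancel unordered_repr (fun a => unordered a.1 a.2).
Proof. by move=> c; rewrite /unordered -surjective_pairing; exact: reprK. Qed.

HB.instance Definition _ :=
  Finite.copy unordered_pair (can_type unordered_reprK).

End UnorderedPairs.

Arguments unordered_pair : clear implicits.

Section Estimators.
Context {R : realType} {Omega : finType}.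
Implicit Types (p : Omega -> Omega -> R) (nu : Omega -> R).
Implicit Types (c : unordered_pair Omega).

(** Trajectories are numbered from 0: u k is the (k+1)-st state of the chain. *)
Definition mle {T : Type} (u : nat -> T -> Omega) (n : nat) (w : T) :
    'M[R]_#|Omega| :=
  n%:R^-1 *: \sum_(k < n) unit_mx (u k w) (u k.+1 w).

Definition sym_init p nu c : R :=
  \sum_u \sum_v (if unordered u v == c then nu u * p u v else 0).

(** Symmetric in the two components of the representative, hence independent
    of its choice. *)
Definition sym_step p c c' : R :=
  let w := unordered_repr c in
  2^-1 * (\sum_v (if unordered w.2 v == c' then p w.2 v else 0))
  + 2^-1 * (\sum_v (if unordered w.1 v == c' then p w.1 v else 0)).

Definition sym_unit_mx c : 'M[R]_#|Omega| :=
  let w := unordered_repr c in 2^-1 *: (unit_mx w.1 w.2 + unit_mx w.2 w.1).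

Definition sym_counting {T : Type} (u : nat -> T -> unordered_pair Omega)
    (n : nat) (w : T) : 'M[R]_#|Omega| :=
  n%:R^-1 *: \sum_(k < n) sym_unit_mx (u k w).

Lemma unorderedC (u v : Omega) : unordered u v = unordered v u.
Proof. by apply/eqmodP; rewrite /= /swap_rel /= eqxx orbT. Qed.

Lemma unordered_reprE (u v : Omega) :
  unordered_repr (unordered u v) = (u, v) \/ unordered_repr (unordered u v) = (v, u).
Proof.
have /eqmodP : unordered_repr (unordered u v) = (u, v) %[mod {eq_quot swap_equiv}].
  by rewrite reprK.
by rewrite /= /swap_rel => /orP [] /eqP ->; [left | right].
Qed.

Lemma sym_step_unordered p u v c' :
  sym_step p (unordered u v) c' =
  2^-1 * (\sum_x (if unordered v x == c' then p v x else 0))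
  + 2^-1 * (\sum_x (if unordered u x == c' then p u x else 0)).
Proof.
by rewrite /sym_step; case: (unordered_reprE u v) => -> //=; rewrite addrC.
Qed.

Lemma sym_unit_mx_unordered u v :
  sym_unit_mx (unordered u v) = 2^-1 *: (unit_mx u v + unit_mx v u).
Proof.
by rewrite /sym_unit_mx; case: (unordered_reprE u v) => -> //=; rewrite addrC.
Qed.

End Estimators.

(* Main.v *)
(* For a kernel [q] with stationary law [m] and a function [F] of two
   consecutive states with mean zero, let [g] solve Poisson's equation
   [g - q g = T F], [T F a] being the conditional mean of [F] given the first
   state.  Then the covariance sums of [S_n = sum F(X_k, X_(k+1))] telescope, and
   [E S_n^2 <= n K (|F|^2 + 4 |F| |g|)] when the initial law is at most [K m].
   Since [|g| <= |F| / gap], and since the squared norms of the matrix entries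
   sum to at most 1, summing over the entries gives
   [E |R_n - D P|_F^2 <= K (1 + 4 / gap) / n], and Jensen's inequality concludes.
   For the iterated Poincare gap the equation is solved by inverting
   [I - P + 1 mu^T], which is where irreducibility is used, and the spectral gap
   bounds [|(I - P) h|] from below as well, by Cauchy-Schwarz.
   For unordered pairs the kernel is [Q = S T] with [S k (u, v) = (k u + k v) / 2]
   and [T S = (I + P) / 2], so [(I - Q)^-1 = I + 2 S (I - P)^-1 T]. *)

Require Import Defs.
From HB Require Import structures.
From mathcomp Require Import all_boot all_order all_algebra.
From mathcomp Require Import all_classical all_reals all_analysis.
From mathcomp Require Import measurable_realfun ring lra.
Set Implicit Arguments.
Unset Strict Implicit.
Unset Printing Implicit Defensive.

Import Order.TTheory GRing.Theory Num.Theory.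
Local Open Scope ring_scope.

(** * Second moments along a finite Markov chain *)

Definition apply_kernel {R : realType} {S : finType} (q : S -> S -> R)
  (h : S -> R) (a : S) : R := \sum_b q a b * h b.

Definition sqnorm {R : realType} {S : finType} (m h : S -> R) : R :=
  \sum_a m a * h a ^+ 2.

(** The past is listed backwards: [phi] receives the current state and the
    list of the previous ones, latest first. *)
Fixpoint path_mean {R : realType} {S : finType} (lam : S -> R)
    (q : S -> S -> R) (n : nat) (phi : S -> seq S -> R) : R :=
  if n is m.+1 then
    path_mean lam q m (fun a s => \sum_b q a b * phi b (a :: s))
  else \sum_a lam a * phi a [::].

(** The past is listed latest first, so the head [c] precedes [a] in time and every term is a
    forward transition. *)
Fixpoint path_sum {R : realType} {S : finType} (F : S -> S -> R)
    (a : S) (s : seq S) : R :=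
  if s is c :: s' then F c a + path_sum F c s' else 0.

Section FiniteChain.
Context {R : realType} {S : finType}.
Implicit Types (m h g f : S -> R) (F : S -> S -> R).

(** Expand the nonnegative variance about the mean. The law [m] will be a row of a kernel or an
    invariant distribution. *)
Lemma mean_sqr_le m h : is_distribution m ->
  (\sum_a m a * h a) ^+ 2 <= sqnorm m h.
Proof.
move=> [m0 m1].
have var c : \sum_a m a * (h a - c) ^+ 2 =
    sqnorm m h - 2 * c * (\sum_a m a * h a) + c ^+ 2 * \sum_a m a.
  rewrite /sqnorm !mulr_sumr -sumrB -big_split /=.
  by apply: eq_bigr => a _; ring.
have : 0 <= \sum_a m a * (h a - \sum_a m a * h a) ^+ 2.
  by apply: sumr_ge0 => a _; rewrite mulr_ge0 ?sqr_ge0.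
by rewrite var m1; lra.
Qed.

Lemma sqnorm_ge0 m h : (forall a, 0 <= m a) -> 0 <= sqnorm m h.
Proof. by move=> m0; apply: sumr_ge0 => a _; rewrite mulr_ge0 ?sqr_ge0. Qed.

Lemma sqnormN m h : sqnorm m (fun a => - h a) = sqnorm m h.
Proof. by apply: eq_bigr => a _; rewrite sqrrN. Qed.

Lemma sqnormD_le m h g : (forall a, 0 <= m a) ->
  sqnorm m (fun a => h a + g a) <= 2 * sqnorm m h + 2 * sqnorm m g.
Proof.
move=> m0; rewrite /sqnorm !mulr_sumr -big_split; apply: ler_sum => a _ /=.
rewrite !(mulrCA 2) -mulrDr ler_wpM2l //.
by have := sqr_ge0 (h a - g a); lra.
Qed.

(** * Contraction of a kernel in the norm of its stationary law *)

Section Stationary.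
Variables (q : S -> S -> R) (m : S -> R).
Hypotheses (q_tr : is_transition q) (m_inv : invariant_distribution q m).

Lemma invariant_mean h : \sum_a m a * apply_kernel q h a = \sum_a m a * h a.
Proof.
have [_ mq] := m_inv.
under eq_bigr do rewrite mulr_sumr.
rewrite exchange_big; apply: eq_bigr => b _ /=.
by under eq_bigr do rewrite mulrA; rewrite -mulr_suml mq.
Qed.

Lemma sqnorm_mean_le F :
  sqnorm m (fun a => \sum_b q a b * F a b) <=
  \sum_a m a * \sum_b q a b * F a b ^+ 2.
Proof.
have [[m0 _] _] := m_inv.
by apply: ler_sum => a _; rewrite ler_wpM2l ?mean_sqr_le.
Qed.

Lemma sqnorm_kernel_le h : sqnorm m (apply_kernel q h) <= sqnorm m h.
Proof.
apply: le_trans (sqnorm_mean_le (fun _ => h)) _.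
by rewrite (invariant_mean (fun a => h a ^+ 2)).
Qed.

End Stationary.

(** * Means over finite paths *)

Section PathMean.
Variables (lam : S -> R) (q : S -> S -> R).
Local Notation E := (path_mean lam q).
Implicit Types (phi psi : S -> seq S -> R).

Lemma eq_path_mean n phi psi :
  (forall a s, size s = n -> phi a s = psi a s) -> E n phi = E n psi.
Proof.
elim: n phi psi => [|n IH] phi psi e /=.
  by apply: eq_bigr => a _; rewrite e.
by apply: IH => a s sz; apply: eq_bigr => b _; rewrite e //= sz.
Qed.

Lemma path_meanD n phi psi :
  E n (fun a s => phi a s + psi a s) = E n phi + E n psi.
Proof.
elim: n phi psi => [|n IH] phi psi /=.
  by rewrite -big_split; apply: eq_bigr => a _; rewrite mulrDr.
rewrite -IH; apply: eq_path_mean => a s _.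
by rewrite -big_split; apply: eq_bigr => b _; rewrite mulrDr.
Qed.

Lemma path_meanZ n c phi : E n (fun a s => c * phi a s) = c * E n phi.
Proof.
elim: n phi => [|n IH] phi /=.
  by rewrite mulr_sumr; apply: eq_bigr => a _; rewrite mulrCA.
rewrite -IH; apply: eq_path_mean => a s _.
by rewrite mulr_sumr; apply: eq_bigr => b _; rewrite mulrCA.
Qed.

Lemma path_mean_sum n (I : finType) (phi : I -> S -> seq S -> R) :
  E n (fun a s => \sum_i phi i a s) = \sum_i E n (phi i).
Proof.
elim: n phi => [|n IH] phi /=.
  by rewrite exchange_big; apply: eq_bigr => a _; rewrite mulr_sumr.
rewrite -IH; apply: eq_path_mean => a s _.
by rewrite exchange_big; apply: eq_bigr => b _; rewrite mulr_sumr.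
Qed.

Hypotheses (lam_d : is_distribution lam) (q_tr : is_transition q).

Lemma path_mean_le n phi psi :
  (forall a s, phi a s <= psi a s) -> E n phi <= E n psi.
Proof.
have [lam0 _] := lam_d.
elim: n phi psi => [|n IH] phi psi e /=.
  by apply: ler_sum => a _; rewrite ler_wpM2l.
apply: IH => a s; apply: ler_sum => b _.
by have [q0 _] := q_tr a; rewrite ler_wpM2l.
Qed.

Lemma path_mean_cst n c : E n (fun _ _ => c) = c.
Proof.
elim: n => [|n IH] /=; first by rewrite -mulr_suml; case: lam_d => _ ->; rewrite mul1r.
rewrite -[RHS]IH; apply: eq_path_mean => a s _.
by rewrite -mulr_suml; case: (q_tr a) => _ ->; rewrite mul1r.
Qed.

Variables (m : S -> R) (K : R).
Hypotheses (m_inv : invariant_distribution q m)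
  (lam_le : forall a, lam a <= K * m a).

(** Each step replaces [h] by its image under [q], which has the same [m]-mean; the domination of
    [lam] by [K m] thus persists at all times. *)
Lemma path_mean_marginal_le n h : (forall a, 0 <= h a) ->
  E n (fun a _ => h a) <= K * \sum_a m a * h a.
Proof.
elim: n h => [|n IH] h h0 /=.
  by rewrite mulr_sumr; apply: ler_sum => a _; rewrite mulrA ler_wpM2r.
rewrite -(invariant_mean m_inv); apply: IH => a.
by apply: sumr_ge0 => b _; case: (q_tr a) => q0 _; rewrite mulr_ge0.
Qed.

(** * Second moments of additive functionals *)

Variables (F : S -> S -> R) (t : R).
Hypothesis t_gt0 : 0 < t.
Let N : R := \sum_a m a * \sum_b q a b * F a b ^+ 2.
Let B n h : R := E n (fun a _ => \sum_b q a b * (F a b * h b)).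
Let A n h : R := E n (fun a s => path_sum F a s * h a).
Let V n : R := E n (fun a s => path_sum F a s ^+ 2).

Lemma increment_sqr_le n :
  E n (fun a _ => \sum_b q a b * F a b ^+ 2) <= K * N.
Proof.
apply: path_mean_marginal_le => a.
by apply: sumr_ge0 => b _; case: (q_tr a) => q0 _; rewrite mulr_ge0 ?sqr_ge0.
Qed.

(** The weight [t] balances the two halves of AM-GM: the increment contributes [t * (K * N)], and
    [h] contributes [t^-1 * (K * (t ^+ 2 * N))], which is the same. *)
Lemma correlation_increment_le n h : 0 <= K -> sqnorm m h <= t ^+ 2 * N ->
  B n h <= K * (t * N).
Proof.
move=> K0 hN.
(* AM-GM: [2 F h <= t F^2 + h^2 / t] *)
have amgm a b : F a b * h b <= 2^-1 * (t * F a b ^+ 2 + t^-1 * h b ^+ 2).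
  have -> : 2^-1 * (t * F a b ^+ 2 + t^-1 * h b ^+ 2) =
      F a b * h b + 2^-1 * t * (F a b - t^-1 * h b) ^+ 2.
    by field; rewrite gt_eqF.
  by rewrite lerDl mulr_ge0 ?sqr_ge0 // mulr_ge0 // ltW.
apply: (@le_trans _ _ (E n (fun a _ =>
    2^-1 * (t * \sum_b q a b * F a b ^+ 2 +
            t^-1 * apply_kernel q (fun b => h b ^+ 2) a)))).
  apply: path_mean_le => a _.
  rewrite !mulr_sumr -big_split mulr_sumr; apply: ler_sum => b _ /=.
  case: (q_tr a) => q0 _; apply: le_trans (ler_wpM2l (q0 b) (amgm a b)) _.
  by rewrite le_eqVlt; apply/orP; left; apply/eqP; ring.
rewrite path_meanZ path_meanD !path_meanZ.
have e1 := increment_sqr_le n.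
have e2 : E n (fun a _ => apply_kernel q (fun b => h b ^+ 2) a)
    <= K * (t ^+ 2 * N).
  apply: le_trans (@path_mean_marginal_le n _ _) _ => [a|].
    by apply: sumr_ge0 => b _; case: (q_tr a) => q0 _; rewrite mulr_ge0 ?sqr_ge0.
  by rewrite (invariant_mean m_inv (fun b => h b ^+ 2)) ler_wpM2l.
apply: (@le_trans _ _ (2^-1 * (t * (K * N) + t^-1 * (K * (t ^+ 2 * N))))).
  rewrite ler_wpM2l ?invr_ge0 //.
  by apply: lerD; rewrite ler_wpM2l ?invr_ge0 // ltW.
by rewrite le_eqVlt; apply/orP; left; apply/eqP; field; rewrite gt_eqF.
Qed.

Lemma correlationS n h : A n.+1 h = A n (apply_kernel q h) + B n h.
Proof.
rewrite /A /B /= -path_meanD; apply: eq_path_mean => a s _ /=.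
rewrite /apply_kernel mulr_sumr -big_split; apply: eq_bigr => b _ /=; ring.
Qed.

(** Unrolling the recursion replaces [h] by its images under [q]. These satisfy the same norm bound
    because [q] is a contraction, so each step costs at most [K * (t * N)]. *)
Lemma correlation_le n h : 0 <= K -> sqnorm m h <= t ^+ 2 * N ->
  A n h <= n%:R * (K * (t * N)).
Proof.
move=> K0; elim: n h => [|n IH] h hN.
  by rewrite /A /= big1 ?mul0r // => a _; rewrite mul0r mulr0.
rewrite correlationS -natr1 mulrDl mul1r lerD ?correlation_increment_le //.
by apply: IH; apply: le_trans hN; exact: sqnorm_kernel_le.
Qed.

(** By Poisson's equation the cross term in [V n.+1] is [2 * (A n g - A n (apply_kernel q g))],
    while [A n.+1 g] is [A n (apply_kernel q g) + B n g]. In [V + 2 A] the images under [q] cancel,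
    and one step adds only a squared increment and [2 * B n g]. *)
Lemma second_moment_correlation_le n g : 0 <= K ->
  (forall a, g a - apply_kernel q g a = \sum_b q a b * F a b) ->
  sqnorm m g <= t ^+ 2 * N ->
  V n + 2 * A n g <= n%:R * (K * N + 2 * (K * (t * N))).
Proof.
move=> K0 gF gN; elim: n => [|n IH].
  rewrite /V /A /= !big1 ?mul0r ?mulr0 ?addr0 // => a _.
    by rewrite mul0r mulr0.
  by rewrite expr0n mulr0.
have -> : V n.+1 = V n + 2 * (A n g - A n (apply_kernel q g)) +
    E n (fun a _ => \sum_b q a b * F a b ^+ 2).
  rewrite /A /V /= [X in 2 * X]addrC -mulN1r -[-1 * _]path_meanZ -path_meanD -path_meanZ.
  rewrite -!path_meanD; apply: eq_path_mean => a s _ /=.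
  have -> : -1 * (path_sum F a s * apply_kernel q g a) + path_sum F a s * g a =
     path_sum F a s * \sum_b q a b * F a b by rewrite -gF; ring.
  have [_ q1] := q_tr a.
  have -> : path_sum F a s ^+ 2 = \sum_b q a b * path_sum F a s ^+ 2.
    by rewrite -mulr_suml q1 mul1r.
  rewrite !mulr_sumr -!big_split.
  by apply: eq_bigr => b _ /=; ring.
rewrite correlationS -natr1 mulrDl mul1r.
have := increment_sqr_le n; have := @correlation_increment_le n g K0 gN.
by move: IH; lra.
Qed.

(* Poisson's equation [g - q g = T F] makes the covariance sums telescope, so
   the bound is linear in [t], not quadratic. *)
Lemma second_moment_le n g : 0 <= K ->
  (forall a, g a - apply_kernel q g a = \sum_b q a b * F a b) ->
  sqnorm m g <= t ^+ 2 * N ->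
  V n <= n%:R * (K * (1 + 4 * t) * N).
Proof.
move=> K0 gF gN; have := @second_moment_correlation_le n g K0 gF gN.
(* A lower bound on [A n g] is the upper bound for [- g]. *)
have /(correlation_le n K0) : sqnorm m (fun a => - g a) <= t ^+ 2 * N.
  by rewrite sqnormN.
have -> : A n (fun a => - g a) = - A n g.
  by rewrite -mulN1r -path_meanZ; apply: eq_path_mean => a s _; rewrite mulN1r mulrN.
lra.
Qed.

End PathMean.

(** The weights [G i a b] are nonnegative with sum 1 over [i], so the stationary variances of all
    coordinates add up to at most 1. Hence the bound does not depend on the size of [I]. *)
Lemma empirical_mean_le (lam : S -> R) (q : S -> S -> R) (m : S -> R) (K t : R)
    (I : finType) (G : I -> S -> S -> R) (n : nat) :
  is_distribution lam -> is_transition q -> invariant_distribution q m ->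
  0 < K -> (forall a, lam a <= K * m a) -> 0 < t ->
  (forall f, \sum_a m a * f a = 0 -> exists2 g : S -> R,
     (forall a, g a - apply_kernel q g a = f a) &
     sqnorm m g <= t ^+ 2 * sqnorm m f) ->
  (forall i a b, 0 <= G i a b) -> (forall a b, \sum_i G i a b = 1) ->
  (0 < n)%N ->
  path_mean lam q n (fun a s => Num.sqrt (\sum_i
     (n%:R^-1 * path_sum (fun x y => G i x y -
         \sum_c m c * \sum_e q c e * G i c e) a s) ^+ 2))
  <= Num.sqrt (K * (1 + 4 * t) / n%:R).
Proof.
move=> lam_d q_tr m_inv K0 lam_le t0 poisson G0 G1 n0.
pose M i := \sum_c m c * \sum_e q c e * G i c e.
pose F i x y := G i x y - M i.
pose N i : R := \sum_a m a * \sum_b q a b * F i a b ^+ 2.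
have [[m0 m1] _] := m_inv.
have q1 a : \sum_b q a b = 1 by case: (q_tr a).
have q0 a b : 0 <= q a b by case: (q_tr a).
have n1 : 0 < n%:R :> R by rewrite ltr0n.
have VF i : path_mean lam q n (fun a s => path_sum (F i) a s ^+ 2) <=
    n%:R * (K * (1 + 4 * t) * N i).
  pose f a := \sum_b q a b * F i a b.
  have f_mean : \sum_a m a * f a = 0.
    have fE a : f a = (\sum_e q a e * G i a e) - M i.
      rewrite -[M i]mul1r -(q1 a) mulr_suml -sumrB.
      by apply: eq_bigr => b _; rewrite mulrBr.
    under eq_bigr do rewrite fE mulrBr.
    by rewrite sumrB -mulr_suml m1 mul1r subrr.
  have [g gf gN] := poisson f f_mean.
  apply: (@second_moment_le _ _ lam_d q_tr m K m_inv lam_le (F i) t t0 n g) => //.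
    exact: ltW.
  apply: le_trans gN _; rewrite ler_wpM2l ?sqr_ge0 //.
  exact: sqnorm_mean_le.
(* A variance is at most the second moment, and [G ^+ 2 <= G] because [G] lies between 0 and 1. *)
have NG i : N i <= M i.
  have -> : N i = \sum_a m a * (\sum_b q a b * (G i a b ^+ 2 - 2 * M i * G i a b))
      + M i ^+ 2.
    have -> : M i ^+ 2 = \sum_a m a * \sum_b q a b * M i ^+ 2.
      under eq_bigr do rewrite -mulr_suml q1 mul1r.
      by rewrite -mulr_suml m1 mul1r.
    rewrite -big_split; apply: eq_bigr => a _ /=.
    rewrite -mulrDr -big_split.
    by congr (_ * _); apply: eq_bigr => b _ /=; rewrite /F; ring.
  have -> : \sum_a m a * (\sum_b q a b * (G i a b ^+ 2 - 2 * M i * G i a b)) =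
    (\sum_a m a * \sum_b q a b * G i a b ^+ 2) - 2 * M i * M i.
    have ME : M i = \sum_a m a * \sum_b q a b * G i a b by [].
    rewrite [X in _ - _ * X]ME [X in _ - X]mulr_sumr -sumrB; apply: eq_bigr => a _.
    rewrite mulrCA -mulrBr; congr (_ * _); rewrite [X in _ - X]mulr_sumr -sumrB.
    by apply: eq_bigr => b _; ring.
  have : \sum_a m a * (\sum_b q a b * G i a b ^+ 2) <= M i.
    apply: ler_sum => a _; rewrite ler_wpM2l //; apply: ler_sum => b _.
    rewrite ler_wpM2l // expr2 ler_piMl // -(G1 a b) (bigD1 i) //= lerDl.
    by rewrite sumr_ge0.
  by have := sqr_ge0 (M i); lra.
have SM : \sum_i M i = 1.
  rewrite exchange_big /= -m1; apply: eq_bigr => a _; rewrite -mulr_sumr.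
  rewrite exchange_big /= -[RHS]mulr1 -(q1 a); congr (_ * _).
  by apply: eq_bigr => b _; rewrite -mulr_sumr G1 mulr1.
have C0 : 0 < K * (1 + 4 * t) / n%:R by rewrite !mulr_gt0 ?invr_gt0 // ltr_wpDl // mulr_gt0.
set s := Num.sqrt _.
have s0 : 0 < s by rewrite sqrtr_gt0.
have s2 : s ^+ 2 = K * (1 + 4 * t) / n%:R by rewrite sqr_sqrtr // ltW.
pose Q a u := \sum_i (n%:R^-1 * path_sum (F i) a u) ^+ 2.
have EQ : path_mean lam q n Q <= s ^+ 2.
  rewrite path_mean_sum.
  apply: (@le_trans _ _ (\sum_i n%:R^-1 ^+ 2 * (n%:R * (K * (1 + 4 * t) * M i)))).
    apply: ler_sum => i _.
    rewrite (_ : path_mean _ _ _ _ = n%:R^-1 ^+ 2 *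
      path_mean lam q n (fun a s => path_sum (F i) a s ^+ 2)); last first.
      by rewrite -path_meanZ; apply: eq_path_mean => a u _; rewrite exprMn.
    rewrite ler_wpM2l ?sqr_ge0 //; apply: le_trans (VF i) _.
    rewrite ler_wpM2l ?ler0n // ler_wpM2l // mulr_ge0 ?(ltW K0) //.
    by rewrite addr_ge0 // mulr_ge0 // ltW.
  rewrite -!mulr_sumr SM s2 le_eqVlt; apply/orP; left; apply/eqP.
  by field; rewrite gt_eqF.
(* Jensen's inequality, through [2 sqrt x <= x / s + s]. *)
apply: (@le_trans _ _ (path_mean lam q n (fun a u => (2 * s)^-1 * (Q a u + s ^+ 2)))).
  apply: path_mean_le => // a u; rewrite -/(Q a u).
  have Q0 : 0 <= Q a u by rewrite sumr_ge0 // => i _; exact: sqr_ge0.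
  rewrite -{2}(sqr_sqrtr Q0) mulrC ler_pdivlMr ?mulr_gt0 //.
  by have := sqr_ge0 (Num.sqrt (Q a u) - s); lra.
rewrite path_meanZ path_meanD path_mean_cst // mulrC ler_pdivrMr ?mulr_gt0 //.
by lra.
Qed.

End FiniteChain.

(** * Expectations of functionals of the trajectory *)

(** The list stops before [x n]: the functionals receive the current state as a separate
    argument. *)
Fixpoint past {S : Type} (x : nat -> S) (n : nat) : seq S :=
  if n is k.+1 then x k :: past x k else [::].

Lemma eq_past {S : Type} (x y : nat -> S) n :
  (forall i, (i < n)%N -> x i = y i) -> past x n = past y n.
Proof.
elim: n => //= n IH e; rewrite e // IH // => i i_lt.
by apply: e; rewrite ltnS ltnW.
Qed.

Section ExpectationPath.
Local Open Scope classical_set_scope.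
Local Open Scope ereal_scope.
Context {R : realType} {d : measure_display} {T : measurableType d}.
Variable Pr : probability T R.

(** Split along the level sets of [Y]. The event [A] is either the next state taking a given value
    or the whole space. *)
Lemma ge0_integral_indic_finite (Z : finType) (Y : T -> Z) (A : set T)
    (f : Z -> R) :
  measurable A -> (forall z, measurable [set w | Y w = z]) ->
  (forall z, (0 <= f z)%R) ->
  \int[Pr]_w (\1_A w * f (Y w))%:E =
  \sum_z (f z)%:E * Pr ([set w | Y w = z] `&` A).
Proof.
move=> mA mY f0.
have mYA z : measurable ([set w | Y w = z] `&` A) by exact: measurableI.
under eq_integral => w _.
  rewrite (_ : (_)%:E =
    \sum_z ((f z) * \1_([set w | Y w = z] `&` A) w)%:E); last first.
    rewrite (bigD1 (Y w)) //= big1 ?adde0.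
      rewrite !indicE in_setI [w \in [set _ | _]]mem_set //=.
      by rewrite mulrC.
    move=> z /eqP zY; rewrite indicE memNset ?mulr0 //.
    by move=> [/= Yz _]; apply: zY; rewrite Yz.
  over.
rewrite ge0_integral_sum //; last 2 first.
- by move=> z; apply/measurable_EFinP; exact: measurable_funM.
- by move=> z w _; rewrite lee_fin mulr_ge0.
apply: eq_bigr => z _.
under eq_integral do rewrite EFinM.
rewrite ge0_integralZl_EFin //; first by rewrite integral_indic // setIT.
by apply/measurable_EFinP; exact: measurable_indic.
Qed.

Variables (S : finType) (lam : S -> R) (q : S -> S -> R) (X : nat -> T -> S).
Hypotheses (X_chain : markov_chain Pr lam q X)
  (q0 : forall a b, (0 <= q a b)%R).

(** The history up to time [n] as a single random variable with finitely many values. *)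
Let path n w : {ffun 'I_n.+1 -> S} := [ffun i : 'I_n.+1 => X i w].

Lemma path_eq_set n (x : {ffun 'I_n.+1 -> S}) :
  [set w | path n w = x] =
  [set w | forall i, (i <= n)%N -> X i w = x (inord i)].
Proof.
apply/seteqP; split => [w /= <- i i_le|w /= e].
  by rewrite ffunE inordK.
by apply/ffunP => i; rewrite ffunE e ?inord_val // -ltnS.
Qed.

Lemma measurable_path n (x : {ffun 'I_n.+1 -> S}) :
  measurable [set w | path n w = x].
Proof.
have [mX _ _] := X_chain.
rewrite path_eq_set.
rewrite (_ : [set w | _] =
  \bigcap_(i < n.+1) [set w | X i w = x (inord i)]) //.
by rewrite bigcap_mkord; apply: bigsetI_measurable => i _; exact: mX.
Qed.

(** This is the Markov property summed over all histories: conditionally on the history, the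
    indicator of the next state has mean [q (X n w) b]. *)
Lemma integral_next_state n (b : S) (f : {ffun 'I_n.+1 -> S} -> R) :
  (forall x, (0 <= f x)%R) ->
  \int[Pr]_w (\1_[set w | X n.+1 w = b] w * f (path n w))%:E =
  \int[Pr]_w (q (X n w) b * f (path n w))%:E.
Proof.
move=> f0; have [mX _ step] := X_chain.
rewrite ge0_integral_indic_finite //; last exact: measurable_path.
(* The trivial indicator allows the same decomposition over histories on the right-hand side. *)
transitivity (\int[Pr]_w (\1_[set: T] w * (q (path n w ord_max) b * f (path n w)))%:E).
  rewrite (@ge0_integral_indic_finite _ (path n) _
    (fun x => q (x ord_max) b * f x)%R) //; last 2 first.
  - exact: measurable_path.
  - by move=> x; rewrite mulr_ge0.
  apply: eq_bigr => x _; rewrite setIT path_eq_set.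
  have := step n (fun i => x (inord i)) b.
  rewrite (_ : inord n = ord_max); last by apply/val_inj; rewrite /= inordK.
  move=> stepE; rewrite (_ : _ `&` _ = [set w | (forall i, (i <= n)%N ->
     X i w = x (inord i)) /\ X n.+1 w = b]) // stepE.
  by rewrite EFinM [LHS]muleC -muleA [RHS]muleC.
apply: eq_integral => w _; rewrite indicE in_setT mul1r ffunE //.
Qed.

(** Induction on [n] peels off the last state: split by its value [b], then replace the indicator by
    [q (X n w) b], which is the recursion defining [path_mean]. *)
Lemma integral_path n (phi : S -> seq S -> R) :
  (forall a s, (0 <= phi a s)%R) ->
  \int[Pr]_w (phi (X n w) (past (fun i => X i w) n))%:E =
  (path_mean lam q n phi)%:E.
Proof.
have [mX X0 _] := X_chain.
elim: n phi => [|n IH] phi phi0 /=.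
  under eq_integral => w _.
    rewrite -[phi _ _]mul1r -(_ : \1_[set: T] w = 1%R); last by rewrite indicE in_setT.
    over.
  rewrite (@ge0_integral_indic_finite _ (X 0%N) _ (phi^~ [::])) //.
  rewrite -sumEFin; apply: eq_bigr => a _.
  by rewrite setIT X0 muleC EFinM.
rewrite -IH; last by move=> a s; apply: sumr_ge0 => b _; rewrite mulr_ge0.
pose g b (x : {ffun 'I_n.+1 -> S}) :=
  phi b (x ord_max :: past (fun i => x (inord i)) n).
have gE b w : g b (path n w) = phi b (X n w :: past (fun i => X i w) n).
  rewrite /g ffunE; congr (phi b (_ :: _)); apply: eq_past => i i_lt.
  by rewrite ffunE inordK // ltnS ltnW.
have mpath (h : {ffun 'I_n.+1 -> S} -> R) : measurable_fun setT (h \o path n).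
  rewrite (_ : h \o path n =
    fun w => (\sum_x h x * \1_[set w | path n w = x] w)%R); last first.
    apply/funext => w /=; rewrite (bigD1 (path n w)) //= big1 ?addr0.
      by rewrite indicE mem_set // mulr1.
    by move=> x /eqP xp; rewrite indicE memNset ?mulr0 //= => /esym.
  apply: measurable_sum => x; apply: measurable_funM => //.
  by apply: measurable_indic; exact: measurable_path.
under eq_integral => w _.
  rewrite (_ : phi _ _ = \sum_b \1_[set w | X n.+1 w = b] w * g b (path n w))%R; last first.
    rewrite (bigD1 (X n.+1 w)) //= big1 ?addr0.
      by rewrite gE indicE mem_set // mul1r.
    by move=> b /eqP bX; rewrite indicE memNset ?mul0r //= => /esym.
  rewrite -sumEFin; over.
under [RHS]eq_integral => w _.
  rewrite -sumEFin; under eq_bigr do rewrite -gE; over.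
rewrite !ge0_integral_sum //.
- by apply: eq_bigr => b _; rewrite integral_next_state // => x; exact: phi0.
- move=> b; apply/measurable_EFinP.
  rewrite (_ : (fun _ => _) = (fun x : {ffun 'I_n.+1 -> S} => q (x ord_max) b * g b x)%R \o path n); last first.
    by apply/funext => w /=; rewrite ffunE.
  exact: mpath.
- by move=> b w _; rewrite lee_fin mulr_ge0 //; exact: phi0.
- move=> b; apply/measurable_EFinP; apply: measurable_funM.
    by apply: measurable_indic; exact: mX.
  exact: (mpath (g b)).
- by move=> b w _; rewrite lee_fin mulr_ge0 //; exact: phi0.
Qed.

Lemma path_sum_past (F : S -> S -> R) (x : nat -> S) n :
  path_sum F (x n) (past x n) = (\sum_(k < n) F (x k) (x k.+1))%R.
Proof. by elim: n => [|n IH]; rewrite ?big_ord0 // big_ord_recr /= IH addrC. Qed.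

End ExpectationPath.

(** * Poincare gaps and Poisson's equation *)

Section IrreducibleChain.
Context {R : realType} {Omega : finType}.
Variables (p : Omega -> Omega -> R) (mu : Omega -> R).
Hypotheses (p_tr : is_transition p) (p_irr : irreducible_chain p)
  (mu_inv : invariant_distribution p mu).
Implicit Types (f g h : Omega -> R).

Let I_P h u := h u - apply_kernel p h u.

(** * Harmonic functions and Poisson's equation in matrix form *)

Lemma sum_enum_val (F : Omega -> R) :
  \sum_(i < #|Omega|) F (enum_val i) = \sum_u F u.
Proof.
rewrite [RHS](reindex (fun i : 'I_#|Omega| => enum_val i)) //.
by apply: onW_bij; exact: enum_val_bij.
Qed.

Let col_of h : 'cV[R]_#|Omega| := \col_i h (enum_val i).

Lemma matrix_of_col h : matrix_of p *m col_of h = col_of (apply_kernel p h).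
Proof.
apply/colP => i; rewrite !mxE /apply_kernel -sum_enum_val.
by apply: eq_bigr => j _; rewrite !mxE.
Qed.

Lemma matrix_pow_ge0 n i j : 0 <= (matrix_of p ^+ n) i j.
Proof.
elim: n i j => [|n IH] i j; first by rewrite expr0 mxE ler0n.
rewrite exprS mxE; apply: sumr_ge0 => k _; rewrite mulr_ge0 // mxE.
by case: (p_tr (enum_val i)).
Qed.

Lemma matrix_pow_harmonic h n :
  (forall u, apply_kernel p h u = h u) ->
  (matrix_of p ^+ n) *m col_of h = col_of h.
Proof.
move=> hh; elim: n => [|n IH]; first by rewrite expr0 mul1mx.
rewrite exprSr -mulmxA matrix_of_col -[RHS]IH; congr (_ *m _).
by apply/colP => i; rewrite !mxE.
Qed.

(** Maximum principle: at a maximum point [u], the value [h u] is a mean of [h] under a power of [p]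
    that gives positive weight to [v], which forces [h v = h u]. *)
Lemma harmonic_constant h :
  (forall u, apply_kernel p h u = h u) -> forall u v, h u = h v.
Proof.
move=> hh u0.
pose u := [arg max_(u > u0) h u]%O.
have uP v : h v <= h u by rewrite /u; case: arg_maxP => // w _; exact.
suff hu v : h v = h u by move=> v; rewrite !hu.
have [n n0] := p_irr u v.
pose c (j : 'I_#|Omega|) := (matrix_of p ^+ n) (enum_rank u) j * (h u - h (enum_val j)).
have c0 j : 0 <= c j by rewrite mulr_ge0 ?matrix_pow_ge0 // subr_ge0.
have one : \sum_j (matrix_of p ^+ n) (enum_rank u) j = 1.
  have /(@matrix_pow_harmonic _ n)/colP/(_ (enum_rank u)) :
      forall u, apply_kernel p (fun _ => 1) u = (fun _ => 1) u.
    by move=> w; rewrite /apply_kernel -mulr_suml mulr1; case: (p_tr w).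
  by rewrite !mxE => <-; apply: eq_bigr => j _; rewrite !mxE mulr1.
have : \sum_j c j = 0.
  under eq_bigr do rewrite /c mulrBr.
  rewrite sumrB -mulr_suml one mul1r.
  have /colP/(_ (enum_rank u)) := @matrix_pow_harmonic h n hh.
  rewrite !mxE enum_rankK => <-; apply/eqP; rewrite subr_eq0; apply/eqP.
  by apply: eq_bigr => j _; rewrite !mxE.
move/psumr_eq0P => /(_ (fun j _ => c0 j)) /(_ (enum_rank v) isT)/eqP.
by rewrite mulf_eq0 gt_eqF //= enum_rankK subr_eq0 => /eqP.
Qed.

(** Some [u] has positive mass, and a power of [p], which also preserves [mu], carries part of this
    mass to [v]. *)
Lemma invariant_gt0 v : 0 < mu v.
Proof.
have [[mu0 mu1] muP] := mu_inv.
have /existsP [u u_gt0] : [exists u, 0 < mu u].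
  apply: contraT; rewrite negb_exists => /forallP mu_le0.
  move: (@oner_neq0 R); rewrite -mu1 big1 ?eqxx // => u _.
  by apply/eqP; rewrite eq_le mu0 leNgt mu_le0.
have [n n_gt0] := p_irr u v.
pose r : 'rV[R]_#|Omega| := \row_i mu (enum_val i).
have rP : r *m (matrix_of p ^+ n) = r.
  elim: (n) => [|k IH]; first by rewrite expr0 mulmx1.
  rewrite exprSr mulmxA IH; apply/rowP => i; rewrite !mxE -muP -sum_enum_val.
  by apply: eq_bigr => j _; rewrite !mxE.
have /rowP/(_ (enum_rank v)) := rP.
rewrite !mxE enum_rankK => <-; rewrite (bigD1 (enum_rank u)) //= ltr_pwDl //.
  by rewrite mxE enum_rankK mulr_gt0.
by apply: sumr_ge0 => j _; rewrite mxE mulr_ge0 ?matrix_pow_ge0.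
Qed.

(** The rank-one term vanishes on mean-zero functions and fixes constants, so [M] agrees with
    [I - P] on the former and with the identity on the latter. *)
Let M : 'M[R]_#|Omega| :=
  1%:M - matrix_of p + \matrix_(i, j) mu (enum_val j).

Lemma regularized_laplacian_col h :
  M *m col_of h = col_of (fun u => I_P h u + \sum_v mu v * h v).
Proof.
rewrite mulmxDl mulmxBl mul1mx matrix_of_col; apply/colP => i.
rewrite !mxE -sum_enum_val; congr (_ + _).
by apply: eq_bigr => j _; rewrite !mxE.
Qed.

Lemma mean_laplacian h : \sum_u mu u * I_P h u = 0.
Proof.
under eq_bigr do rewrite /I_P mulrBr.
by rewrite sumrB (invariant_mean mu_inv) subrr.
Qed.

(** If [M] kills [h], averaging against [mu] shows that [h] has mean zero, since [I - P] has
    mean-zero range. Then [h] is harmonic, hence constant, hence zero. *)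
Lemma regularized_laplacian_unit : M \in unitmx.
Proof.
have [[_ mu1] _] := mu_inv.
(* [det0P] yields a row vector in the left kernel; transposing turns it into a function killed by
   [M]. *)
rewrite -unitmx_tr unitmxE unitfE; apply/negP => /det0P [v v_neq0 vM].
pose h u := v 0 (enum_rank u).
have vh : v^T = col_of h by apply/colP => i; rewrite !mxE /h enum_valK.
have Mh u : I_P h u + \sum_v mu v * h v = 0.
  have : M *m col_of h = 0 by rewrite -vh -[M]trmxK -trmx_mul vM trmx0.
  by rewrite regularized_laplacian_col => /colP/(_ (enum_rank u)); rewrite !mxE enum_rankK.
have h_mean : \sum_v mu v * h v = 0.
  have : \sum_u mu u * (I_P h u + \sum_v mu v * h v) = 0.
    by apply: big1 => u _; rewrite Mh mulr0.
  under eq_bigr do rewrite mulrDr.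
  by rewrite big_split /= mean_laplacian add0r -mulr_suml mu1 mul1r.
have h_harm u : apply_kernel p h u = h u.
  by apply/esym/eqP; rewrite -subr_eq0 -(Mh u) h_mean addr0.
have h0 u : h u = 0.
  rewrite -h_mean -[LHS]mul1r -mu1 mulr_suml; apply: eq_bigr => w _.
  by rewrite (harmonic_constant h_harm u w).
move/negP: v_neq0; apply; apply/eqP/rowP => i.
by rewrite mxE -[i]enum_valK; exact: h0.
Qed.

Lemma poisson_solvable f : \sum_u mu u * f u = 0 ->
  exists2 g, forall u, I_P g u = f u & \sum_u mu u * g u = 0.
Proof.
move=> f_mean; have [[_ mu1] _] := mu_inv.
pose w := invmx M *m col_of f.
pose g u := w (enum_rank u) 0.
have wg : w = col_of g by apply/colP => i; rewrite [RHS]mxE /g enum_valK.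
have Mg u : I_P g u + \sum_v mu v * g v = f u.
  have : M *m w = col_of f by rewrite mulKVmx // regularized_laplacian_unit.
  by rewrite wg regularized_laplacian_col => /colP/(_ (enum_rank u)); rewrite !mxE enum_rankK.
have g_mean : \sum_v mu v * g v = 0.
  rewrite -[RHS]f_mean; under [RHS]eq_bigr do rewrite -Mg mulrDr.
  by rewrite big_split /= mean_laplacian add0r -mulr_suml mu1 mul1r.
by exists g => // u; rewrite -Mg g_mean addr0.
Qed.

(** This serves to make the gaps positive; the constant, which depends on the chain, does not enter
    the final rate. *)
Lemma laplacian_bounded_below : exists2 c : R, 0 < c &
  forall h, \sum_u mu u * h u = 0 -> sqnorm mu h <= c * sqnorm mu (I_P h).
Proof.
have [mu_d _] := mu_inv; have mu0 u : 0 <= mu u by case: mu_d.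
pose B u v := invmx M (enum_rank u) (enum_rank v).
pose c u := \sum_v (B u v / mu v) ^+ 2.
have c0 u : 0 <= c u by apply: sumr_ge0 => v _; exact: sqr_ge0.
exists (1 + \sum_u mu u * c u).
  by rewrite ltr_pwDl // sumr_ge0 // => u _; rewrite mulr_ge0.
move=> h h_mean.
have N0 := sqnorm_ge0 (I_P h) mu0.
(* Dividing the inverse matrix by [mu v] presents [h u] as a [mu]-mean, to which [mean_sqr_le]
   applies. *)
have hB u : h u = \sum_v mu v * (B u v / mu v * I_P h v).
  have : invmx M *m (M *m col_of h) = col_of h.
    by rewrite mulKmx // regularized_laplacian_unit.
  rewrite regularized_laplacian_col h_mean => /colP/(_ (enum_rank u)).
  rewrite !mxE enum_rankK => <-; rewrite -sum_enum_val; apply: eq_bigr => j _.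
  rewrite mxE addr0 /B enum_valK mulrA; congr (_ * _).
  by rewrite mulrC divfK // gt_eqF // invariant_gt0.
have hc u : h u ^+ 2 <= c u * sqnorm mu (I_P h).
  rewrite {1}hB; apply: le_trans (mean_sqr_le _ mu_d) _.
  rewrite /sqnorm mulr_sumr; apply: ler_sum => v _.
  rewrite exprMn mulrCA ler_wpM2r //; first by rewrite mulr_ge0 ?sqr_ge0.
  rewrite /c (bigD1 v) //= lerDl sumr_ge0 // => w _; exact: sqr_ge0.
apply: (@le_trans _ _ ((\sum_u mu u * c u) * sqnorm mu (I_P h))).
  rewrite mulr_suml; apply: ler_sum => u _.
  by rewrite -mulrA ler_wpM2l.
by rewrite ler_wpM2r // lerDr.
Qed.

Lemma sqnorm_gt0 (h : {ffun Omega -> R}) : h != 0 -> 0 < sqnorm mu h.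
Proof.
have [[mu0 _] _] := mu_inv => h_neq0.
have [u hu] : exists u, h u != 0.
  apply/existsP; apply: contraNT h_neq0; rewrite negb_exists => /forallP hz.
  by apply/eqP/ffunP => u; rewrite ffunE; apply/eqP; have := hz u; rewrite negbK.
rewrite /sqnorm (bigD1 u) //= ltr_pwDl //.
  by rewrite mulr_gt0 ?invariant_gt0 // lt_neqAle eq_sym sqrf_eq0 hu sqr_ge0.
by apply: sumr_ge0 => v _; rewrite mulr_ge0 ?sqr_ge0.
Qed.

(** Guarantees that the infimum and the supremum defining the gaps range over nonempty sets. *)
Lemma nontrivial_mean_zero : (2 <= #|Omega|)%N ->
  exists2 h : {ffun Omega -> R}, mean_zero mu h & h != 0.
Proof.
move=> /card_gt1P [a [b [_ _ ab]]].
exists [ffun u => if u == a then mu b else if u == b then - mu a else 0].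
  rewrite /mean_zero /= (bigD1 a) //= (bigD1 b) 1?eq_sym //= big1 => [|u /andP[ua ub]].
    by rewrite !ffunE eqxx eq_sym (negPf ab) eqxx; ring.
  by rewrite ffunE (negPf ua) (negPf ub) mulr0.
apply/eqP => /ffunP /(_ a); rewrite !ffunE eqxx => /eqP.
by rewrite gt_eqF // invariant_gt0.
Qed.

Lemma laplacian_sqnorm_le h : sqnorm mu (I_P h) <= 4 * sqnorm mu h.
Proof.
have [[mu0 _] _] := mu_inv.
apply: (le_trans (sqnormD_le _ _ mu0)); rewrite sqnormN.
by have := sqnorm_kernel_le p_tr mu_inv h; lra.
Qed.

(** The value of [I_P h] at [u] is the mean of [h u - h v] over the next state [v]. Jensen bounds
    its square by the mean of [(h u - h v) ^+ 2], and invariance turns the total into twice the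
    Dirichlet form. *)
Lemma laplacian_sqnorm_le_dirichlet h :
  sqnorm mu (I_P h) <= 2 * \sum_u mu u * (h u * I_P h u).
Proof.
have [_ p1] : (forall u v, 0 <= p u v) /\ (forall u, \sum_v p u v = 1).
  by split => u; case: (p_tr u).
have -> : sqnorm mu (I_P h) = sqnorm mu (fun u => \sum_v p u v * (h u - h v)).
  apply: eq_bigr => u _; congr (_ * _ ^+ 2).
  under [RHS]eq_bigr do rewrite mulrBr.
  by rewrite sumrB -mulr_suml p1 mul1r.
apply: le_trans (sqnorm_mean_le p_tr mu_inv _) _.
have -> : \sum_u mu u * (\sum_v p u v * (h u - h v) ^+ 2) =
    \sum_u mu u * h u ^+ 2 - 2 * (\sum_u mu u * (h u * apply_kernel p h u))
    + \sum_u mu u * apply_kernel p (fun v => h v ^+ 2) u.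
  rewrite mulr_sumr -sumrB -big_split; apply: eq_bigr => u _ /=.
  have -> : mu u * h u ^+ 2 = mu u * (\sum_v p u v * h u ^+ 2).
    by rewrite -mulr_suml p1 mul1r.
  rewrite /apply_kernel !mulr_sumr -sumrB -big_split.
  by apply: eq_bigr => v _ /=; ring.
rewrite (invariant_mean mu_inv (fun v => h v ^+ 2)).
have -> : \sum_u mu u * (h u * I_P h u) =
   \sum_u mu u * h u ^+ 2 - \sum_u mu u * (h u * apply_kernel p h u).
  by rewrite -sumrB; apply: eq_bigr => u _; rewrite /I_P; ring.
lra.
Qed.

(* The homogeneous form of the bounds, free of square roots and quotients. *)
Definition has_poincare_gap (delta : R) : Prop :=
  0 < delta /\ forall h, \sum_u mu u * h u = 0 ->
    delta ^+ 2 * sqnorm mu h <= sqnorm mu (fun u => h u - apply_kernel p h u).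

(** The operator [I - P] has norm at most 2. This lets additive constants be absorbed into multiples
    of the inverse gap. *)
Lemma poincare_gap_le2 delta : (2 <= #|Omega|)%N -> has_poincare_gap delta ->
  delta <= 2.
Proof.
move=> /nontrivial_mean_zero [h h_mean h_neq0] [delta0 gap].
have := le_trans (gap h h_mean) (laplacian_sqnorm_le h).
rewrite ler_pM2r ?sqnorm_gt0 // => delta_sq.
rewrite -ler_sqr ?nnegrE ?(ltW delta0) //; apply: le_trans delta_sq _.
by rewrite expr2 -natrM.
Qed.

Lemma poisson_gap delta f : has_poincare_gap delta -> \sum_u mu u * f u = 0 ->
  exists2 g : Omega -> R, forall u, g u - apply_kernel p g u = f u &
    sqnorm mu g <= delta^-1 ^+ 2 * sqnorm mu f.
Proof.
move=> [delta0 gap] /poisson_solvable [g gf g_mean]; exists g => //.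
rewrite exprVn mulrC ler_pdivlMr ?exprn_gt0 // mulrC.
apply: le_trans (gap g g_mean) _; rewrite le_eqVlt; apply/orP; left; apply/eqP.
by apply: eq_bigr => u _; rewrite -gf.
Qed.

(** * Homogeneous bounds from the infimum and the supremum *)

Lemma norm2E (h : {ffun Omega -> R}) : norm2 mu h = Num.sqrt (sqnorm mu h).
Proof.
congr Num.sqrt; apply: eq_bigr => u _; by rewrite expr2 mulrA.
Qed.

Lemma norm2_laplacianE (h : {ffun Omega -> R}) :
  norm2 mu (h - transition_op p h) = Num.sqrt (sqnorm mu (I_P h)).
Proof.
by rewrite norm2E; congr Num.sqrt; apply: eq_bigr => u _; rewrite !ffunE.
Qed.

Lemma sqnorm_finfun h : sqnorm mu [ffun u => h u] = sqnorm mu h.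
Proof. by apply: eq_bigr => u _; rewrite ffunE. Qed.

Lemma laplacian_finfun h : sqnorm mu (I_P [ffun u => h u]) = sqnorm mu (I_P h).
Proof.
apply: eq_bigr => u _; rewrite /I_P ffunE; congr (_ * (_ - _) ^+ 2).
by apply: eq_bigr => v _; rewrite ffunE.
Qed.

Local Open Scope classical_set_scope.

Lemma iterated_poincare_gapP : (2 <= #|Omega|)%N ->
  has_poincare_gap (iterated_poincare_gap p mu).
Proof.
move=> /nontrivial_mean_zero [h0 h0_mean h0_neq0].
have [[mu0 _] _] := mu_inv.
have [c c0 hc] := laplacian_bounded_below.
have gap_gt0 : 0 < iterated_poincare_gap p mu.
  apply: (@lt_le_trans _ _ (Num.sqrt c)^-1); first by rewrite invr_gt0 sqrtr_gt0.
  apply: lb_le_inf; first by exists (norm2 mu (h0 - transition_op p h0) / norm2 mu h0), h0.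
  move=> _ [h [h_mean h_neq0] <-]; rewrite norm2_laplacianE norm2E.
  have h_gt0 := sqnorm_gt0 h_neq0.
  rewrite ler_pdivlMr ?sqrtr_gt0 // mulrC ler_pdivrMr ?sqrtr_gt0 // mulrC.
  by rewrite -sqrtrM ?(ltW c0) //; apply: ler_wsqrtr; exact: hc.
split=> // h h_mean; have [h_eq0|h_gt0] := eqVneq (sqnorm mu h) 0.
  by rewrite h_eq0 mulr0 sqnorm_ge0.
have {}h_gt0 : 0 < sqnorm mu h by rewrite lt_neqAle eq_sym h_gt0 sqnorm_ge0.
pose h' := [ffun u => h u].
have h'_neq0 : h' != 0.
  apply: contraL h_gt0 => /eqP h'0; rewrite -sqnorm_finfun -/h' h'0 -leNgt.
  by rewrite /sqnorm big1 // => u _; rewrite ffunE expr0n mulr0.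
have : iterated_poincare_gap p mu <= norm2 mu (h' - transition_op p h') / norm2 mu h'.
  apply: ge_inf.
    by exists 0 => _ [g _ <-]; rewrite divr_ge0 // sqrtr_ge0.
  exists h' => //; split => //; rewrite /mean_zero /= -[RHS]h_mean.
  by apply: eq_bigr => u _; rewrite ffunE.
rewrite norm2_laplacianE norm2E sqnorm_finfun laplacian_finfun.
rewrite ler_pdivlMr ?sqrtr_gt0 // -ler_sqr ?nnegrE ?sqrtr_ge0 //.
  by rewrite exprMn !sqr_sqrtr ?sqnorm_ge0.
by rewrite mulr_ge0 ?sqrtr_ge0 // ltW.
Qed.

(** Positivity is deduced from the iterated gap through the Dirichlet form. The lower bound on
    [I - P] then follows from Cauchy-Schwarz applied to [h] and [I_P h]. *)
Lemma spectral_gapP : (2 <= #|Omega|)%N -> has_poincare_gap (spectral_gap p mu).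
Proof.
move=> Omega2; have [delta0 gap] := iterated_poincare_gapP Omega2.
have [h0 h0_mean h0_neq0] := nontrivial_mean_zero Omega2.
set delta := iterated_poincare_gap p mu in delta0 gap.
have [[mu0 _] _] := mu_inv.
have innerE (h : {ffun Omega -> R}) : inner mu h (transition_op p h) =
    sqnorm mu h - \sum_u mu u * (h u * I_P h u).
  rewrite -sumrB; apply: eq_bigr => u _; rewrite ffunE /I_P /apply_kernel.
  by ring.
set D := [set inner mu h (transition_op p h) / norm2 mu h ^+ 2 |
  h in [set h | mean_zero mu h /\ h != 0]].
(* This bound is needed twice: it makes the supremum a genuine one and it places it strictly below
   1. *)
have D_ub : ubound D (1 - delta ^+ 2 / 2).
  move=> _ [h [h_mean h_neq0] <-].
  have h_gt0 := sqnorm_gt0 h_neq0.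
  rewrite innerE norm2E sqr_sqrtr ?(ltW h_gt0) // ler_pdivrMr // mulrBl mul1r lerD2l lerN2.
  have := le_trans (gap h h_mean) (laplacian_sqnorm_le_dirichlet h); lra.
have eta0 : 0 < spectral_gap p mu.
  rewrite subr_gt0; apply: (@le_lt_trans _ _ (1 - delta ^+ 2 / 2)).
    apply: ge_sup => //.
    by exists (inner mu h0 (transition_op p h0) / norm2 mu h0 ^+ 2), h0.
  by rewrite ltrBlDr ltrDl divr_gt0 // exprn_gt0.
split=> // h h_mean; have [h_eq0|h_gt0] := eqVneq (sqnorm mu h) 0.
  by rewrite h_eq0 mulr0 sqnorm_ge0.
have {}h_gt0 : 0 < sqnorm mu h by rewrite lt_neqAle eq_sym h_gt0 sqnorm_ge0.
pose h' := [ffun u => h u].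
have h'_neq0 : h' != 0.
  apply: contraL h_gt0 => /eqP h'0; rewrite -sqnorm_finfun -/h' h'0 -leNgt.
  by rewrite /sqnorm big1 // => u _; rewrite ffunE expr0n mulr0.
have h'_mean : mean_zero mu h'.
  by rewrite /mean_zero /= -[RHS]h_mean; apply: eq_bigr => u _; rewrite ffunE.
set eta := spectral_gap p mu in eta0 *.
have : inner mu h' (transition_op p h') / norm2 mu h' ^+ 2 <= 1 - eta.
  rewrite /eta /spectral_gap opprB addrC subrK; apply: ub_le_sup.
    by exists (1 - delta ^+ 2 / 2).
  by exists h'.
rewrite innerE norm2E sqr_sqrtr ?sqnorm_ge0 // sqnorm_finfun ler_pdivrMr //.
rewrite mulrBl mul1r lerD2l lerN2 => dirichlet.
(* Cauchy-Schwarz through [eta h (h - P h) <= (eta^2 h^2 + (h - P h)^2) / 2]. *)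
have cs : eta * (\sum_u mu u * (h' u * I_P h' u)) <=
    2^-1 * (eta ^+ 2 * sqnorm mu h + sqnorm mu (I_P h)).
  rewrite -sqnorm_finfun -laplacian_finfun -/h' /sqnorm !mulr_sumr -big_split.
  rewrite mulr_sumr; apply: ler_sum => u _ /=.
  rewrite -subr_ge0 (_ : _ - _ = 2^-1 * (mu u * (eta * h' u - I_P h' u) ^+ 2)).
    by rewrite mulr_ge0 // mulr_ge0 // sqr_ge0.
  by field.
have := ler_wpM2l (ltW eta0) dirichlet.
rewrite mulrA -expr2; move: cs; set X := eta * _; set Y := eta ^+ 2 * _.
by rewrite -/(I_P h); lra.
Qed.

End IrreducibleChain.

(** * The two estimators *)

(** Letting [A] depend on two consecutive states covers both estimators: transitions of the original
    chain, and single states of the chain of unordered pairs. *)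
Lemma expectation_estimator_le {R : realType} {d : measure_display}
    {T : measurableType d} (Pr : probability T R) (S : finType)
    (lam : S -> R) (q : S -> S -> R) (X : nat -> T -> S) (m : S -> R)
    (K t : R) (k : nat) (A : S -> S -> 'M[R]_k) (D : 'M[R]_k) (n : nat) :
  markov_chain Pr lam q X ->
  is_distribution lam -> is_transition q -> invariant_distribution q m ->
  0 < K -> (forall a, lam a <= K * m a) -> 0 < t ->
  (forall f, \sum_a m a * f a = 0 -> exists2 g : S -> R,
     (forall a, g a - apply_kernel q g a = f a) &
     sqnorm m g <= t ^+ 2 * sqnorm m f) ->
  (forall a b i j, 0 <= A a b i j) ->
  (forall a b, \sum_i \sum_j A a b i j = 1) ->
  (forall i j, D i j = \sum_c m c * \sum_e q c e * A c e i j) ->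
  (0 < n)%N ->
  ('E_Pr [fun w => frobenius_norm
      (n%:R^-1 *: \sum_(l < n) A (X l w) (X l.+1 w) - D)]
   <= (Num.sqrt (K * (1 + 4 * t) / n%:R))%:E)%E.
Proof.
move=> X_chain lam_d q_tr m_inv K0 lam_le t0 poisson A0 A1 DE n0.
have q0 a b : 0 <= q a b by case: (q_tr a).
have n_neq0 : n%:R != 0 :> R by rewrite pnatr_eq0 -lt0n.
pose G (ij : 'I_k * 'I_k) a b := A a b ij.1 ij.2.
pose phi a s := Num.sqrt (\sum_ij (n%:R^-1 * path_sum (fun x y => G ij x y -
         \sum_c m c * \sum_e q c e * G ij c e) a s) ^+ 2).
have -> : (fun w => frobenius_norm
      (n%:R^-1 *: \sum_(l < n) A (X l w) (X l.+1 w) - D)) =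
    (fun w => phi (X n w) (past (fun i => X i w) n)).
  apply/funext => w; rewrite /frobenius_norm pair_bigA; congr Num.sqrt.
  apply: eq_bigr => -[i j] _ /=; congr (_ ^+ 2).
  rewrite (path_sum_past _ (fun i => X i w)) !mxE summxE sumrB mulrBr; congr (_ - _).
  by rewrite sumr_const card_ord -DE -[D i j *+ n]mulr_natl mulrA mulVf // mul1r.
rewrite unlock (integral_path X_chain q0) //; last by move=> a s; exact: sqrtr_ge0.
rewrite lee_fin; apply: empirical_mean_le => //.
- by move=> ij a b; exact: A0.
- by move=> a b; rewrite -(A1 a b) pair_bigA.
Qed.

(** The constant 18 fits both estimators: with [delta <= 2], the choice [t = 1 / delta] gives
    [delta + 4], and [t = 4 / delta] gives [delta + 16]. *)
Lemma rate_le {R : rcfType} (K delta t : R) (n : nat) :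
  0 < delta -> 0 <= K -> (0 < n)%N -> delta * (1 + 4 * t) <= 18 ->
  Num.sqrt (K * (1 + 4 * t) / n%:R) <=
  Num.sqrt (18 * K) / Num.sqrt (n%:R * delta).
Proof.
move=> delta0 K0 n0 h; have n1 : 0 < n%:R :> R by rewrite ltr0n.
rewrite ler_pdivlMr ?sqrtr_gt0 ?mulr_gt0 // mulrC -sqrtrM; last first.
  by rewrite mulr_ge0 // ltW.
apply: ler_wsqrtr.
rewrite (_ : _ * _ = K * (delta * (1 + 4 * t))) ?[18 * K]mulrC ?ler_wpM2l //.
by field; rewrite gt_eqF.
Qed.

Section Estimators.
Context {R : realType} {Omega : finType}.
Variables (p : Omega -> Omega -> R) (mu nu : Omega -> R) (K delta : R).
Hypotheses (Omega2 : (2 <= #|Omega|)%N) (p_tr : is_transition p)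
  (p_irr : irreducible_chain p) (mu_inv : invariant_distribution p mu)
  (nu_d : is_distribution nu) (K_gt0 : 0 < K)
  (nu_le : forall u, nu u <= K * mu u) (gap : has_poincare_gap p mu delta).

Let p0 u v : 0 <= p u v. Proof. by case: (p_tr u). Qed.
Let p1 u : \sum_v p u v = 1. Proof. by case: (p_tr u). Qed.
Let mu0 u : 0 <= mu u. Proof. by case: mu_inv => -[]. Qed.
Let delta0 : 0 < delta. Proof. by case: gap. Qed.
Let delta2 : delta <= 2.
Proof. exact: poincare_gap_le2 p_tr p_irr mu_inv _ Omega2 gap. Qed.

(** * The maximal likelihood estimator *)

Lemma unit_mxE (u v : Omega) i j :
  unit_mx u v i j = ((enum_val i == u) && (enum_val j == v))%:R :> R.
Proof.
by rewrite mxE -{1}[i]enum_valK -{1}[j]enum_valK !(inj_eq enum_rank_inj).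
Qed.

Lemma sum_unit_mx (u v : Omega) : \sum_i \sum_j unit_mx u v i j = 1 :> R.
Proof.
rewrite (bigD1 (enum_rank u)) //= (bigD1 (enum_rank v)) //= mxE !eqxx /=.
rewrite big1 => [|j jv]; last by rewrite mxE eqxx (negPf jv).
rewrite big1 ?addr0 // => i iu; apply: big1 => j _.
by rewrite mxE (negPf iu).
Qed.

Lemma diag_matrixE i j :
  (diag_of mu *m matrix_of p) i j =
  mu (enum_val i) * p (enum_val i) (enum_val j).
Proof. by rewrite mul_diag_mx !mxE. Qed.

Lemma mean_unit_mx i j :
  \sum_u mu u * \sum_v p u v * unit_mx u v i j =
  mu (enum_val i) * p (enum_val i) (enum_val j).
Proof.
rewrite (bigD1 (enum_val i)) //= (bigD1 (enum_val j)) //= unit_mxE !eqxx mulr1.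
rewrite big1 => [|v jv]; last first.
  by rewrite unit_mxE [_ == v]eq_sym (negPf jv) andbF mulr0.
rewrite addr0 big1 ?addr0 // => u iu; rewrite big1 ?mulr0 // => v _.
by rewrite unit_mxE [_ == u]eq_sym (negPf iu) mulr0.
Qed.

Lemma mle_bound d (T : measurableType d) (Pr : probability T R)
    (u : nat -> T -> Omega) n : (0 < n)%N -> markov_chain Pr nu p u ->
  ('E_Pr [fun w => frobenius_norm
       (mle u n w - diag_of mu *m matrix_of p)]
   <= (Num.sqrt (18 * K) / Num.sqrt (n%:R * delta))%:E)%E.
Proof.
move=> n0 u_chain; apply: (@le_trans _ _ (Num.sqrt (K * (1 + 4 * delta^-1) / n%:R))%:E).
  apply: (@expectation_estimator_le _ _ _ _ _ _ _ _ mu _ _ _ unit_mx _ _ u_chain) => //.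
  - by rewrite invr_gt0.
  - by move=> f f_mean; exact: (poisson_gap p_tr p_irr mu_inv gap).
  - by move=> a b i j; rewrite mxE ler0n.
  - exact: sum_unit_mx.
  - by move=> i j; rewrite diag_matrixE mean_unit_mx.
rewrite lee_fin; apply: rate_le => //; first exact: ltW.
rewrite (_ : _ * _ = delta + 4); first by have := delta2; lra.
by field; rewrite gt_eqF.
Qed.

(** * The chain of unordered pairs *)

Let pair_mean (phi : unordered_pair Omega -> R) u : R :=
  \sum_v p u v * phi (unordered u v).

Lemma sum_sym_init (m : Omega -> R) (phi : unordered_pair Omega -> R) :
  \sum_c sym_init p m c * phi c = \sum_u m u * pair_mean phi u.
Proof.
rewrite /sym_init; under eq_bigr do rewrite mulr_suml.
rewrite exchange_big; apply: eq_bigr => u _ /=.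
under eq_bigr do rewrite mulr_suml.
rewrite exchange_big mulr_sumr; apply: eq_bigr => v _ /=.
rewrite (bigD1 (unordered u v)) //= eqxx big1 ?addr0 ?mulrA // => c.
by rewrite eq_sym => /negPf ->; rewrite mul0r.
Qed.

Lemma apply_sym_step (phi : unordered_pair Omega -> R) u v :
  apply_kernel (sym_step p) phi (unordered u v) =
  2^-1 * (pair_mean phi u + pair_mean phi v).
Proof.
have half w : \sum_c (\sum_x (if unordered w x == c then p w x else 0)) * phi c =
    pair_mean phi w.
  under eq_bigr do rewrite mulr_suml.
  rewrite exchange_big; apply: eq_bigr => x _ /=.
  rewrite (bigD1 (unordered w x)) //= eqxx big1 ?addr0 // => c.
  by rewrite eq_sym => /negPf ->; rewrite mul0r.
rewrite /apply_kernel; under eq_bigr do rewrite sym_step_unordered mulrDl -!mulrA.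
by rewrite big_split /= -!mulr_sumr !half mulrDr addrC.
Qed.

Lemma unorderedP (c : unordered_pair Omega) : exists u v, c = unordered u v.
Proof.
by exists (unordered_repr c).1, (unordered_repr c).2; rewrite unordered_reprK.
Qed.

Lemma pair_mean1 u : pair_mean (fun _ => 1) u = 1.
Proof. by rewrite /pair_mean -mulr_suml p1 mul1r. Qed.

Lemma sym_init_distribution (m : Omega -> R) :
  is_distribution m -> is_distribution (sym_init p m).
Proof.
move=> [m0 m1]; split=> [c|].
  apply: sumr_ge0 => u _; apply: sumr_ge0 => v _.
  by case: ifP => // _; rewrite mulr_ge0.
under eq_bigr do rewrite -[sym_init _ _ _]mulr1.
rewrite (sum_sym_init m (fun _ => 1)) -[RHS]m1.
by apply: eq_bigr => u _; rewrite pair_mean1 mulr1.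
Qed.

Lemma sym_step_transition : is_transition (sym_step p).
Proof.
move=> c; split=> [c'|].
  rewrite /sym_step addr_ge0 // mulr_ge0 ?invr_ge0 //; apply: sumr_ge0 => v _;
  by case: ifP.
have [u [v ->]] := unorderedP c.
under eq_bigr do rewrite -[sym_step _ _ _]mulr1.
rewrite -/(apply_kernel (sym_step p) (fun _ => 1) _) apply_sym_step !pair_mean1.
by field.
Qed.

(** By invariance of [mu], both ends of the initial pair have law [mu]. *)
Lemma sum_sym_init_average (k : Omega -> R) (phi : unordered_pair Omega -> R) :
  (forall u v, phi (unordered u v) = 2^-1 * (k u + k v)) ->
  \sum_c sym_init p mu c * phi c = \sum_u mu u * k u.
Proof.
move=> phiE; rewrite sum_sym_init.
have -> : \sum_u mu u * pair_mean phi u =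
   \sum_u (2^-1 * (mu u * k u) + 2^-1 * (mu u * apply_kernel p k u)).
  apply: eq_bigr => u _; rewrite /pair_mean /apply_kernel.
  have -> : 2^-1 * (mu u * k u) = \sum_v p u v * (2^-1 * (mu u * k u)).
    by rewrite -mulr_suml p1 mul1r.
  rewrite !mulr_sumr -big_split; apply: eq_bigr => v _ /=.
  by rewrite phiE; ring.
rewrite big_split /= -!mulr_sumr (invariant_mean mu_inv).
by field.
Qed.

(** Test against the indicator [phi] of [c']: its image under the kernel averages [pair_mean phi]
    over the two ends of the pair, so its mean is the [mu]-mean of [pair_mean phi], which is also
    the mean of [phi]. *)
Lemma sym_init_invariant :
  invariant_distribution (sym_step p) (sym_init p mu).
Proof.
split; first by apply: sym_init_distribution; case: mu_inv.
move=> c'; pose phi c : R := (c == c')%:R.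
have phiE (f : unordered_pair Omega -> R) : \sum_c f c * phi c = f c'.
  rewrite (bigD1 c') //= /phi eqxx mulr1 big1 ?addr0 // => c /negPf ->.
  by rewrite mulr0.
rewrite -[RHS](phiE (sym_init p mu)) [RHS]sum_sym_init.
under [LHS]eq_bigr => c _ do rewrite -(phiE (sym_step p c)).
exact: (sum_sym_init_average (fun u v => apply_sym_step phi u v)).
Qed.

Lemma sym_init_le c : sym_init p nu c <= K * sym_init p mu c.
Proof.
rewrite /sym_init mulr_sumr; apply: ler_sum => u _.
rewrite mulr_sumr; apply: ler_sum => v _.
by case: ifP => _; rewrite ?mulr0 // mulrA ler_wpM2r.
Qed.

(* With [T = pair_mean], [S k (u, v) = (k u + k v) / 2] and [Q = S T] the
   symmetric kernel, [T S = (I + P) / 2], so [k = 2 (I - P)^-1 T f] gives the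
   solution [f + S k] of Poisson's equation for [Q]. *)
Lemma sym_poisson (f : unordered_pair Omega -> R) :
  \sum_c sym_init p mu c * f c = 0 ->
  exists2 g : unordered_pair Omega -> R,
    (forall c, g c - apply_kernel (sym_step p) g c = f c) &
    sqnorm (sym_init p mu) g <= (4 / delta) ^+ 2 * sqnorm (sym_init p mu) f.
Proof.
move=> f_mean.
have [|k kE kN] := @poisson_gap _ _ p mu p_tr p_irr mu_inv delta
    (fun u => 2 * pair_mean f u) gap.
  under eq_bigr do rewrite mulrCA.
  by rewrite -mulr_sumr -sum_sym_init f_mean mulr0.
pose Sk (c : unordered_pair Omega) :=
  2^-1 * (k (unordered_repr c).1 + k (unordered_repr c).2).
have SkE u v : Sk (unordered u v) = 2^-1 * (k u + k v).
  by rewrite /Sk; case: (unordered_reprE u v) => -> //=; rewrite [k v + _]addrC.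
(* The choice of [k] gives [T f = (k - P k) / 2], while [T (S k) = (k + P k) / 2]; the sum is
   [k]. *)
have TgE u : pair_mean (fun c => f c + Sk c) u = k u.
  have -> : pair_mean (fun c => f c + Sk c) u =
      pair_mean f u + 2^-1 * (k u + apply_kernel p k u).
    have -> : k u = \sum_v p u v * k u by rewrite -mulr_suml p1 mul1r.
    rewrite -[X in 2^-1 * X]big_split mulr_sumr -big_split; apply: eq_bigr => v _ /=; rewrite SkE; ring.
  by have := kE u; lra.
exists (fun c => f c + Sk c).
  move=> c; have [u [v ->]] := unorderedP c.
  by rewrite apply_sym_step !TgE SkE addrK.
have init0 c : 0 <= sym_init p mu c.
  by case: (sym_init_distribution (proj1 mu_inv)).
apply: le_trans (sqnormD_le _ _ init0) _.
have Tf_le : sqnorm mu (pair_mean f) <= sqnorm (sym_init p mu) f.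
  rewrite [leRHS](sum_sym_init mu (fun c => f c ^+ 2)).
  exact: (sqnorm_mean_le p_tr mu_inv (fun u v => f (unordered u v))).
have Sk_le : sqnorm (sym_init p mu) Sk <= sqnorm mu k.
  pose psi c := 2^-1 * (k (unordered_repr c).1 ^+ 2 + k (unordered_repr c).2 ^+ 2).
  rewrite -[leRHS](@sum_sym_init_average _ psi); last first.
    move=> u v; rewrite /psi; case: (unordered_reprE u v) => -> //=.
    by rewrite [k v ^+ 2 + _]addrC.
  apply: ler_sum => c _; rewrite ler_wpM2l //.
  rewrite /Sk /psi; set x := k _; set y := k _.
  by have := sqr_ge0 (x - y); lra.
have k_le : sqnorm mu k <= 4 * (delta^-1 ^+ 2 * sqnorm (sym_init p mu) f).
  apply: le_trans kN _; rewrite mulrCA ler_wpM2l ?sqr_ge0 //.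
  have -> : sqnorm mu (fun u => 2 * pair_mean f u) = 4 * sqnorm mu (pair_mean f).
    by rewrite /sqnorm mulr_sumr; apply: eq_bigr => u _; ring.
  by rewrite ler_wpM2l.
have f0 := sqnorm_ge0 f init0.
(* Here [1 <= 4 / delta ^+ 2] because [delta <= 2], so [f] obeys the same bound as [k]; the two
   doubled terms then total 16. *)
have f_le : sqnorm (sym_init p mu) f <= 4 * (delta^-1 ^+ 2 * sqnorm (sym_init p mu) f).
  rewrite mulrA ler_peMl // exprVn ler_pdivlMr ?exprn_gt0 // mul1r.
  rewrite (_ : 4 = 2 ^+ 2); last by rewrite expr2 -natrM.
  by rewrite ler_sqr ?nnegrE // ltW.
rewrite (_ : (4 / delta) ^+ 2 * _ =
  16 * (delta^-1 ^+ 2 * sqnorm (sym_init p mu) f)); last by ring.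
by move: (le_trans Sk_le k_le) f_le; lra.
Qed.

(** * The symmetric counting estimator *)

Hypothesis mu_rev : reversible p mu.

Lemma sym_unit_mx_ge0 (c : unordered_pair Omega) i j :
  0 <= sym_unit_mx c i j :> R.
Proof.
have [u [v ->]] := unorderedP c.
by rewrite sym_unit_mx_unordered !mxE mulr_ge0 ?invr_ge0 // addr_ge0.
Qed.

Lemma sum_sym_unit_mx (c : unordered_pair Omega) :
  \sum_i \sum_j sym_unit_mx c i j = 1 :> R.
Proof.
have [u [v ->]] := unorderedP c; rewrite sym_unit_mx_unordered.
have -> : \sum_i \sum_j (2^-1 *: (unit_mx u v + unit_mx v u)) i j =
  2^-1 * (\sum_i \sum_j unit_mx u v i j + \sum_i \sum_j unit_mx v u i j) :> R.
  rewrite -big_split mulr_sumr; apply: eq_bigr => i _.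
  by rewrite -big_split mulr_sumr; apply: eq_bigr => j _; rewrite !mxE.
by rewrite !sum_unit_mx; field.
Qed.

(** The stationary mean is the symmetric part of [D P]; detailed balance says that [D P] is already
    symmetric. *)
Lemma mean_sym_unit_mx i j :
  \sum_c sym_init p mu c * sym_unit_mx c i j =
  mu (enum_val i) * p (enum_val i) (enum_val j).
Proof.
rewrite (sum_sym_init mu (fun c => sym_unit_mx c i j)).
have -> : \sum_u mu u * pair_mean (fun c => sym_unit_mx c i j) u =
   2^-1 * (\sum_u mu u * \sum_v p u v * unit_mx u v i j) +
   2^-1 * (\sum_u mu u * \sum_v p u v * unit_mx u v j i).
  rewrite !mulr_sumr -big_split; apply: eq_bigr => u _ /=.
  rewrite /pair_mean !mulr_sumr -big_split; apply: eq_bigr => v _ /=.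
  by rewrite sym_unit_mx_unordered !mxE [(j == _) && _]andbC; ring.
by rewrite !mean_unit_mx [mu (enum_val j) * _]mu_rev; field.
Qed.

Lemma sym_counting_bound d (T : measurableType d) (Pr : probability T R)
    (u : nat -> T -> unordered_pair Omega) n :
  (0 < n)%N -> markov_chain Pr (sym_init p nu) (sym_step p) u ->
  ('E_Pr [fun w => frobenius_norm
       (sym_counting u n w - diag_of mu *m matrix_of p)]
   <= (Num.sqrt (18 * K) / Num.sqrt (n%:R * delta))%:E)%E.
Proof.
move=> n0 u_chain; apply: (@le_trans _ _ (Num.sqrt (K * (1 + 4 * (4 / delta)) / n%:R))%:E).
  apply: (@expectation_estimator_le _ _ _ _ _ _ _ _ (sym_init p mu) _ _ _
     (fun c _ => sym_unit_mx c) _ _ u_chain) => //.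
  - exact: sym_init_distribution.
  - exact: sym_step_transition.
  - exact: sym_init_invariant.
  - exact: sym_init_le.
  - by rewrite divr_gt0.
  - exact: sym_poisson.
  - by move=> a b i j; exact: sym_unit_mx_ge0.
  - by move=> a b; exact: sum_sym_unit_mx.
  - move=> i j; rewrite diag_matrixE -mean_sym_unit_mx; apply: eq_bigr => c _.
    by rewrite -mulr_suml (proj2 (sym_step_transition c)) mul1r.
rewrite lee_fin; apply: rate_le => //; first exact: ltW.
rewrite (_ : _ * _ = delta + 16); first by have := delta2; lra.
by field; rewrite gt_eqF.
Qed.

End Estimators.

Lemma le_max_ratio {R : realType} {Omega : finType} (nu mu : Omega -> R) K u :
  0 < mu u -> max_ratio nu mu <= K -> nu u <= K * mu u.
Proof.
move=> mu0 nuK; rewrite -ler_pdivrMr //; apply: le_trans nuK.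
exact: (le_bigmax _ (fun u => nu u / mu u)).
Qed.

Unset Implicit Arguments.

Theorem theorem1p3 (R : realType) (K : R) (hK : 1 <= K) :
  exists C : R, 0 < C /\
    forall (Omega : finType) (hOmega : (2 <= #|Omega|)%N)
      (p : Omega -> Omega -> R) (mu nu : Omega -> R)
      (hp : is_transition p) (hirr : irreducible_chain p)
      (hmu : invariant_distribution p mu)
      (hnu : is_distribution nu) (hK' : max_ratio nu mu <= K)
      (n : nat) (hn : (0 < n)%N),
    (forall (d : measure_display) (T : measurableType d)
        (Pr : probability T R) (u : nat -> T -> Omega),
      markov_chain Pr nu p u ->
      ('E_Pr [fun w => frobenius_norm
                 (mle u n w - diag_of mu *m matrix_of p)]
       <= (C / Num.sqrt (n%:R * iterated_poincare_gap p mu))%:E)%E)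
    /\
    (reversible p mu ->
      (forall (d : measure_display) (T : measurableType d)
          (Pr : probability T R) (u : nat -> T -> Omega),
        markov_chain Pr nu p u ->
        ('E_Pr [fun w => frobenius_norm
                   (mle u n w - diag_of mu *m matrix_of p)]
         <= (C / Num.sqrt (n%:R * spectral_gap p mu))%:E)%E)
      /\
      (forall (d : measure_display) (T : measurableType d)
          (Pr : probability T R) (u : nat -> T -> unordered_pair Omega),
        markov_chain Pr (sym_init p nu) (sym_step p) u ->
        ('E_Pr [fun w => frobenius_norm
                   (sym_counting u n w - diag_of mu *m matrix_of p)]
         <= (C / Num.sqrt (n%:R * spectral_gap p mu))%:E)%E)).
Proof.
have K0 : 0 < K by apply: lt_le_trans hK.
exists (Num.sqrt (18 * K)); split; first by rewrite sqrtr_gt0 mulr_gt0.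
move=> Omega hOmega p mu nu hp hirr hmu hnu hK' n hn.
(* Positivity of [mu] matters: a quotient by zero is zero, so the ratio bound would say nothing
   where [mu] vanishes. *)
have nu_le u : nu u <= K * mu u.
  by apply: le_max_ratio hK'; exact: invariant_gt0 hp hirr hmu u.
have gap_p := iterated_poincare_gapP hp hirr hmu hOmega.
have gap := spectral_gapP hp hirr hmu hOmega.
split=> [d T Pr u u_chain|rev].
  exact: (mle_bound hOmega hp hirr hmu hnu K0 nu_le gap_p hn u_chain).
split=> d T Pr u u_chain.
  exact: (mle_bound hOmega hp hirr hmu hnu K0 nu_le gap hn u_chain).
exact: (sym_counting_bound hOmega hp hirr hmu hnu K0 nu_le gap rev hn u_chain).
Qed.
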